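(* For every $s\in S^{+}$ and every $v\in\mathcal{AP}(s)$, $$m(v)=(-1)^{b(v)-1}a(v),$$ where $m(v)=m(v|s)$ is the value of the M\''obius function of the poset $\mathcal{AP}(s)$ on the pair consisting of $v$ and the one-word partition $s$, $b(v)$ is the number of words of $v$, and $a(v)$ is the number of admissible shuffles of $v$.
   Context: $S=FS(\{z,w\})$ is the free semigroup of all finite words in $z,w$ including the empty word $1$; $S^{+}=S\setminus\{1\}$. A subword of $s=s_1\ldots s_n$ is a subsequence $s_{i_1}\ldots s_{i_k}$, $1\le i_1<\ldots<i_k\le n$, with its indices remembered; $r\cup t$ denotes the subword whose index set is the union of those of the disjoint subwords $r,t$. A partition of $s\in S^+$ is a sequence $u=(u_1,\ldots,u_p)$ of nonempty subwords with pairwise disjoint index sets whose union is $\{1,\ldots,n\}$, ordered by increasing first index; $b(u)=p$. A letter $s_j$ not belonging to $u_l=s_{i_1}\ldots s_{i_k}$ is inner with respect to $u_l$ if $i_1<j<i_k$. The partition $u$ is admissible if no letter equal to $w$ is inner with respect to any word $u_l$ of $u$ to which it does not belong. $\mathcal{AP}(s)$ is the set of admissible partitions of $s$, partially ordered by refinement ($v\le u$ iff $v$ is a, not necessarily proper, refinement of $u$); the maximal element is the one-word partition, denoted $s$. The M\''obius function is defined by $m(u|u)=1$ and $m(u|v)=-\sum_{u\le t<v}m(u|t)$ for $u<v$ in $\mathcal{AP}(s)$. For $u=(u_1,\ldots,u_p)\in\mathcal{AP}(s)$, an admissible shuffle of $u$ is a sequence $u=u^0\to u^1\to\cdots\to u^{p-1}=s$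 of admissible partitions of $s$ such that for each $1\le k\le p-1$ one has $u^k=j_l(u^{k-1})$ for some $1\le l\le p-k$, where $j_l(v_1,\ldots,v_m)=(v_1,\ldots,v_{l-1},v_l\cup v_m,v_{l+1},\ldots,v_{m-1})$ for $1\le l\le m-1$ (the last word is merged with one of the previous words). $a(u)$ is the number of admissible shuffles of $u$ (in particular $a(s)=1$ for the one-word partition). *)

(* Defs.v *)
From HB Require Import structures.
From mathcomp Require Import all_boot all_order all_algebra.

Set Implicit Arguments.
Unset Strict Implicit.
Unset Printing Implicit Defensive.

Import Order.TTheory GRing.Theory.

(* The recursion is made structural by a fuel argument bounding the number of *)
(* elements below the second argument; mobiusxx and mobius_lt are the defining*)
(* equations. Incomparable pairs get the value 0.                             *)
Fixpoint mobius_rec (d : Order.disp_t) (T : finPOrderType d) (k : nat)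
    (u v : T) : int :=
  if u == v then 1%R else
  if k is k'.+1 then (- \sum_(t : T | (u <= t < v)%O) mobius_rec k' u t)%R
  else 0%R.

Definition mobius (d : Order.disp_t) (T : finPOrderType d) (u v : T) : int :=
  mobius_rec #|T| u v.

Lemma mobius_rec_fuel (d : Order.disp_t) (T : finPOrderType d) (k k' : nat)
    (u v : T) :
  #|[set t : T | (t < v)%O]| <= k -> #|[set t : T | (t < v)%O]| <= k' ->
  mobius_rec k u v = mobius_rec k' u v.
Proof.
have empty0 k0 (x : T) : #|[set t : T | (t < x)%O]| <= 0 ->
    mobius_rec k0 u x = if u == x then 1%R else 0%R.
  rewrite leqn0 cards_eq0 => /eqP e0; case: k0 => [|k0] //=.
  case: eqP => // _; rewrite big1 ?oppr0 // => t /andP[_ tx].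
  by have := in_set0 t; rewrite -e0 inE tx.
elim: k k' v => [|k IHk] [|k'] v hk hk'.
- by [].
- by rewrite !empty0.
- by rewrite !empty0.
rewrite /=; case: eqP => // _; congr (- _)%R.
have lt_card (t : T) : (t < v)%O ->
    #|[set x : T | (x < t)%O]| < #|[set x : T | (x < v)%O]|.
  move=> tv; apply: proper_card; apply/properP; split.
    by apply/subsetP=> x; rewrite !inE => /lt_trans; apply.
  by exists t; rewrite !inE ?ltxx.
apply: eq_bigr => t /andP[_ /lt_card ht]; apply: IHk; rewrite -ltnS.
  exact: leq_trans hk.
exact: leq_trans hk'.
Qed.

Lemma mobiusxx (d : Order.disp_t) (T : finPOrderType d) (u : T) :
  mobius u u = 1%R.
Proof. by rewrite /mobius; case: #|T| => [|k] /=; rewrite eqxx. Qed.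

Lemma mobius_lt (d : Order.disp_t) (T : finPOrderType d) (u v : T) :
  (u < v)%O -> mobius u v = (- \sum_(t : T | (u <= t < v)%O) mobius u t)%R.
Proof.
move=> uv.
rewrite /mobius (@mobius_rec_fuel _ _ #|T| #|T|.+1) ?max_card //=; last first.
  exact: leq_trans (max_card _) _.
by rewrite lt_eqF.
Qed.

Variant letter := Lz | Lw.

Definition bool_of_letter (a : letter) : bool := if a is Lw then true else false.
Definition letter_of_bool (b : bool) : letter := if b then Lw else Lz.
Lemma bool_of_letterK : cancel bool_of_letter letter_of_bool.
Proof. by case. Qed.
HB.instance Definition _ := Equality.copy letter (can_type bool_of_letterK).

(* A subword of a word of length n is encoded by its set of positions,        *)
(* numbered from 0.                                                           *)
Notation subword n := {set 'I_n}.

(* Both are meaningful only for nonempty A. *)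
Definition first_index n (A : subword n) : nat := \big[minn/n]_(i in A) i.
Definition last_index n (A : subword n) : nat := \max_(i in A) i.

(* Strict sortedness also excludes repetitions in u. *)
Definition is_partition n (u : seq (subword n)) : bool :=
  partition [set:: u] [set: 'I_n] &&
  sorted (fun A B => first_index A < first_index B) u.

Definition inner n (A : subword n) (j : 'I_n) : bool :=
  (j \notin A) && (first_index A < j < last_index A).

Definition admissible (s : seq letter) (u : seq (subword (size s))) : bool :=
  [forall j : 'I_(size s),
     (tnth (in_tuple s) j == Lw) ==> all (fun A => ~~ inner A j) u].

Record AP (s : seq letter) := MkAP {
  words :> seq (subword (size s));
  _ : is_partition words && admissible words }.

HB.instance Definition _ s := [isSub for @words s].
HB.instance Definition _ s := [Choice of AP s by <:].
HB.instance Definition _ s := [Countable of AP s by <:].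

Lemma AP_partition s (u : AP s) : partition [set:: words u] [set: 'I_(size s)].
Proof. by case: u => u /= /andP[/andP[]]. Qed.

Lemma first_index_trans n :
  transitive (fun A B : subword n => first_index A < first_index B).
Proof. by move=> B A C; apply: ltn_trans. Qed.

Lemma AP_sorted s (u : AP s) :
  sorted (fun A B => first_index A < first_index B) (words u).
Proof. by case: u => u /= /andP[/andP[]]. Qed.

Lemma AP_uniq s (u : AP s) : uniq (words u).
Proof.
apply: (sorted_uniq (@first_index_trans _) _ (AP_sorted u)) => A.
exact: ltnn.
Qed.

Lemma AP_neq0 s (u : AP s) A : A \in words u -> A != set0.
Proof.
case/and3P: (AP_partition u) => _ _ u0 Au.
by apply: contraNneq u0 => <-; rewrite inE.
Qed.

Lemma AP_size s (u : AP s) : size (words u) <= size s.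
Proof.
have <- : #|[set:: words u]| = size (words u).
  by rewrite cardsE; apply/card_uniqP/AP_uniq.
rewrite -[leqRHS]card_ord -cardsT (card_partition (AP_partition u)) -sum1_card.
apply: leq_sum => A; rewrite inE => /AP_neq0; by rewrite card_gt0.
Qed.

Definition AP_bseq s (u : AP s) : (size s).-bseq (subword (size s)) :=
  Bseq (AP_size u).
Definition bseq_AP s (u : (size s).-bseq (subword (size s))) : option (AP s) :=
  insub (val u).
Lemma AP_bseqK s : pcancel (@AP_bseq s) (@bseq_AP s).
Proof. by move=> u; rewrite /bseq_AP /= valK. Qed.
HB.instance Definition _ s : isFinite (AP s) := PCanIsFinite (@AP_bseqK s).

Definition refines s (v u : AP s) : bool :=
  all (fun A : subword (size s) => has (fun B : subword (size s) => A \subset B) (words u))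
      (words v).

Lemma refinesP s (v u : AP s) :
  reflect (forall A, A \in words v -> exists2 B : subword (size s), B \in words u & A \subset B)
          (refines v u).
Proof.
apply: (iffP allP) => h A Av; first by case/hasP: (h A Av) => B; exists B.
by case: (h A Av) => B Bu AB; apply/hasP; exists B.
Qed.

Lemma refines_refl s : reflexive (@refines s).
Proof. by move=> u; apply/refinesP=> A Au; exists A. Qed.

Lemma refines_trans s : transitive (@refines s).
Proof.
move=> u v t /refinesP vu /refinesP ut; apply/refinesP=> A /vu[B /ut[C Ct BC] AB].
by exists C; last exact: subset_trans BC.
Qed.

Lemma refines_anti s : antisymmetric (@refines s).
Proof.
have sub (u v : AP s) : refines u v -> refines v u ->
    {subset words u <= words v}.
  move=> /refinesP uv /refinesP vu A Au.
  have [B Bv AB] := uv A Au; have [C Cu BC] := vu B Bv.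
  have [/eqP eAC|neAC] := boolP (A == C).
    suff -> : A = B by [].
    by apply/eqP; rewrite eqEsubset AB eAC.
  case/and3P: (AP_partition u) => _ /trivIsetP /(_ A C) tI _.
  have := tI; rewrite !inE => /(_ Au Cu neAC) dAC.
  have /set0Pn[x xA] := AP_neq0 Au.
  have xC : x \in C by apply: (subsetP BC); apply: (subsetP AB).
  by have := disjointFr dAC xA; rewrite xC.
move=> u v /andP[uv vu]; apply: val_inj => /=.
apply: (irr_sorted_eq (@first_index_trans _) _ (AP_sorted u) (AP_sorted v)).
  by move=> A; apply: ltnn.
by move=> A; apply/idP/idP; apply: sub.
Qed.

Fact AP_display : Order.disp_t. Proof. exact: Order.Disp tt tt. Qed.
HB.instance Definition _ s := Order.Le_isPOrder.Build AP_display (AP s)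
  (@refines_refl s) (@refines_anti s) (@refines_trans s).

Lemma AP_leE s (u v : AP s) : (u <= v)%O = refines u v.
Proof. by []. Qed.

Lemma one_word_subproof (s : seq letter) : s != [::] ->
  is_partition [:: [set: 'I_(size s)]] && @admissible s [:: [set: 'I_(size s)]].
Proof.
move=> sN; rewrite /is_partition /= andbT; apply/andP; split; last first.
  by apply/forallP=> j; rewrite /= /inner inE /= implybT.
have -> : [set:: [:: [set: 'I_(size s)]]] = [set [set: 'I_(size s)]].
  by apply/setP=> A; rewrite !inE.
apply/and3P; split.
- by rewrite /cover big_set1.
- apply/trivIsetP=> A B; rewrite !inE => /eqP-> /eqP->; by rewrite eqxx.
- by rewrite inE eq_sym -card_gt0 cardsT card_ord lt0n size_eq0.
Qed.

Definition one_word (s : seq letter) (sN : s != [::]) : AP s :=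
  MkAP (one_word_subproof sN).

Definition num_words s (u : AP s) : nat := size (words u).

(* Here l is numbered from 0, so that 0 <= l < size v - 1. *)
Definition join_last n (l : nat) (v : seq (subword n)) : seq (subword n) :=
  mkseq (fun i => if i == l then nth set0 v i :|: last set0 v else nth set0 v i)
        (size v).-1.

(* c lists u^0, ..., u^(p-1) with p = num_words u; the k below is one less   *)
(* than in the condition u^k = j_l (u^(k-1)), 1 <= k <= p-1, 1 <= l <= p-k.   *)
Definition is_shuffle s (u : AP s) (c : (num_words u).-tuple (AP s)) : bool :=
  [&& nth u c 0 == u,
      words (nth u c (num_words u).-1) == [:: [set: 'I_(size s)]] &
      [forall k : 'I_(num_words u).-1, exists l : 'I_(num_words u - k.+1),
         words (nth u c k.+1) == join_last l (words (nth u c k))]].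

Definition num_shuffles s (u : AP s) : nat :=
  #|[set c : (num_words u).-tuple (AP s) | is_shuffle c]|.

(* Main.v *)
(* By Mobius inversion it is enough to show that, for v with at least two     *)
(* words, the numbers (-1)^(b(t)-1) a(t) with t >= v sum to 0. Let X be the   *)
(* last word of v. If X is a word of t >= v, then it is the last word of t,   *)
(* and a(t) is the sum of a(t') over all t' obtained from t by a single       *)
(* admissible join. Each t' >= v in which X is not a word arises from exactly *)
(* one such t, got by cutting X out of the word of t' containing it; this t   *)
(* is admissible because v and t' are. Hence the terms with X in t cancel     *)
(* those with X not in t.                                                     *)

Require Import Defs.
From mathcomp Require Import all_boot all_order all_algebra.

Set Implicit Arguments.
Unset Strict Implicit.
Unset Printing Implicit Defensive.

Import Order.TTheory GRing.Theory.

Lemma sum_mobius (d : Order.disp_t) (T : finPOrderType d) (u v : T) :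
  (u <= v)%O -> (\sum_(t : T | (u <= t <= v)%O) mobius u t = (u == v)%:R)%R.
Proof.
rewrite le_eqVlt => /predU1P[<-|uv].
  rewrite (big_pred1 u) ?mobiusxx ?eqxx // => t.
  by rewrite /= eq_le andbC.
rewrite (bigD1 v) /=; last by rewrite (ltW uv) lexx.
rewrite (mobius_lt uv) (lt_eqF uv) [X in (- _ + X)%R](_ : _ =
  \sum_(t : T | (u <= t < v)%O) mobius u t)%R ?addNr //.
by apply: eq_bigl => t; rewrite lt_neqAle -andbA [(t != v) && _]andbC.
Qed.

Lemma mobius_dual_unique (d : Order.disp_t) (T : finPOrderType d) (v : T)
    (f : T -> int) :
  f v = 1%R ->
  (forall u, (u < v)%O -> \sum_(t : T | (u <= t <= v)%O) f t = 0)%R ->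
  forall u, (u <= v)%O -> mobius u v = f u.
Proof.
move=> fv f0 u uv.
have sumf t : (t <= v)%O ->
    (\sum_(t' : T | (t <= t' <= v)%O) f t' = (t == v)%:R)%R.
  rewrite le_eqVlt => /predU1P[->|tv]; last by rewrite f0 // (lt_eqF tv).
  by rewrite (big_pred1 v) ?fv ?eqxx // => t'; rewrite /= eq_le andbC.
transitivity (\sum_(t : T | (u <= t <= v)%O)
    mobius u t * \sum_(t' : T | (t <= t' <= v)%O) f t')%R.
  rewrite (bigD1 v) /=; last by rewrite uv lexx.
  rewrite sumf // eqxx mulr1 big1 ?addr0 // => t /andP[/andP[_ tv] tNv].
  by rewrite sumf // (negbTE tNv) mulr0.
under eq_bigr => t _ do rewrite mulr_sumr.
rewrite (exchange_big_dep (fun t' => (u <= t' <= v)%O)) /=; last first.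
  by move=> t t' /andP[ut _] /andP[tt' ->]; rewrite (le_trans ut tt').
transitivity (\sum_(t' : T | (u <= t' <= v)%O) (u == t')%:R * f t')%R.
  apply: eq_bigr => t' /andP[ut' t'v]; rewrite -mulr_suml; congr (_ * _)%R.
  rewrite -(sum_mobius ut'); apply: eq_bigl => t.
  rewrite t'v andbT; case: (boolP (u <= t)%O) => //= _.
  by case: (boolP (t <= t')%O) => [tt'|]; rewrite ?andbF ?(le_trans tt').
rewrite (bigD1 u) /=; last by rewrite lexx.
rewrite eqxx mul1r big1 ?addr0 // => t' /andP[_ t'Nu].
by rewrite eq_sym (negbTE t'Nu) mul0r.
Qed.

Fixpoint num_paths (T : finType) (e : rel T) (F : pred T) (k : nat) (x : T) :
    nat :=
  if k is k'.+1 then \sum_(y | e x y) num_paths e F k' y else F x.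

Lemma card_paths (T : finType) (e : rel T) (F : pred T) (k : nat) (x : T) :
  #|[set c : k.-tuple T | path e x c && F (last x c)]| = num_paths e F k x.
Proof.
elim: k x => [|k IHk] x /=.
  case Fx: (F x); last by apply: eq_card0 => c; rewrite inE tuple0 /= Fx.
  rewrite (eq_card (B := {: 0.-tuple T})) ?card_tuple // => c.
  by rewrite !inE tuple0 /= Fx.
rewrite -sum1dep_card (reindex (fun p : T * k.-tuple T => [tuple of p.1 :: p.2])) /=; last first.
  exists (fun c : k.+1.-tuple T => (thead c, [tuple of behead c])) => [[y c]|c] _ /=.
    by congr (_, _); apply: val_inj.
  by rewrite [RHS]tuple_eta.
under eq_bigl => p do rewrite -andbA.
rewrite -(pair_big_dep (e x) (fun y (c : k.-tuple T) => path e y c && F (last y c)) (fun _ _ => 1)) /=.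
by apply: eq_bigr => y _; rewrite sum1dep_card IHk.
Qed.

Section FirstLast.
Variables (n : nat).
Implicit Types (A B : subword n).

Lemma first_index_le A i : i \in A -> first_index A <= i.
Proof.
rewrite -[i \in A]andTb -(mem_index_enum i) andbC -mem_filter.
rewrite /first_index -big_filter; elim: (filter _ _) => // j r IHr.
rewrite inE big_cons geq_min => /predU1P[->|/IHr->]; rewrite ?leqnn ?orbT //.
Qed.

Lemma first_index_in A : A != set0 -> exists2 i, i \in A & first_index A = i.
Proof.
case/set0Pn => x xA; case: (arg_minnP (fun i : 'I_n => nat_of_ord i) xA) => i iA imin.
exists i => //; apply/eqP; rewrite eqn_leq first_index_le //=.
rewrite /first_index; elim/big_rec: _ => [|j m jA im]; first exact/ltnW.
by rewrite leq_min imin.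
Qed.

Lemma last_index_ge A i : i \in A -> i <= last_index A.
Proof. by move=> iA; apply: (leq_bigmax_cond (F := fun i : 'I_n => nat_of_ord i)). Qed.

Lemma last_index_in A : A != set0 -> exists2 i, i \in A & last_index A = i.
Proof.
rewrite -card_gt0 => A0.
have [i iA Ai] := eq_bigmax_cond (fun i : 'I_n => nat_of_ord i) A0.
by exists i => //; apply: Ai.
Qed.

Lemma first_index_subset A B :
  A != set0 -> A \subset B -> first_index B <= first_index A.
Proof.
by case/first_index_in => i iA -> /subsetP/(_ i iA)/first_index_le.
Qed.

End FirstLast.

Section Words.
Variable s : seq letter.
Implicit Types (u v t : AP s) (A B : subword (size s)).

Lemma AP_cover u x : exists2 A, A \in words u & x \in A.
Proof.
case/and3P: (AP_partition u) => /eqP cu _ _.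
have : x \in [set: 'I_(size s)] by rewrite inE.
by rewrite -cu => /bigcupP[A]; rewrite inE; exists A.
Qed.

Lemma AP_inj u A B x :
  A \in words u -> B \in words u -> x \in A -> x \in B -> A = B.
Proof.
move=> Au Bu xA xB; apply/eqP; apply: contraTT xB => neAB.
case/and3P: (AP_partition u) => _ /trivIsetP/(_ A B) + _.
by rewrite !inE => /(_ Au Bu neAB)/disjointFr->.
Qed.

Lemma is_partitionI (u : seq (subword (size s))) :
  (forall x, exists2 A, A \in u & x \in A) ->
  (forall A B x, A \in u -> B \in u -> x \in A -> x \in B -> A = B) ->
  set0 \notin u ->
  sorted (fun A B => first_index A < first_index B) u ->
  is_partition u.
Proof.
move=> ucov uinj u0 usort; rewrite /is_partition usort andbT.
apply/and3P; split; last by rewrite inE.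
- apply/eqP/setP => x; rewrite !inE; apply/bigcupP.
  by have [A Au xA] := ucov x; exists A; rewrite ?inE.
- apply/trivIsetP => A B; rewrite !inE => Au Bu; apply: contraNT.
  by case/pred0Pn => x /= /andP[xA xB]; apply/eqP/(uinj A B x).
Qed.

Lemma admissibleP (u : seq (subword (size s))) :
  reflect (forall j A, tnth (in_tuple s) j = Lw -> A \in u -> ~~ inner A j)
          (admissible u).
Proof.
apply: (iffP forallP) => [h j A jw Au|h j].
  by have := h j; rewrite jw eqxx => /allP/(_ A Au).
by apply/implyP => /eqP jw; apply/allP => A; apply: h.
Qed.

Lemma AP_admissible u j A x y :
  tnth (in_tuple s) j = Lw -> A \in words u -> x \in A -> y \in A ->
  x < j -> j < y -> j \in A.
Proof.
move=> jw Au xA yA xj jy; have : admissible (words u).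
  by case: u Au => u /= /andP[].
move=> /admissibleP/(_ j A jw Au); apply: contraNT => jA; rewrite /inner jA /=.
by rewrite (leq_ltn_trans (first_index_le xA)) //= (leq_trans jy) ?last_index_ge.
Qed.

Lemma size_AP_gt0 u : s != [::] -> 0 < num_words u.
Proof.
rewrite -size_eq0 -lt0n => s0; have [A] := AP_cover u (Ordinal s0).
by rewrite /num_words; case: (words u).
Qed.

Lemma words1 u A : words u = [:: A] -> A = setT.
Proof.
move=> uA; apply/setP => x; rewrite inE.
by have [B] := AP_cover u x; rewrite uA inE => /eqP ->.
Qed.

Lemma num_words1 (sN : s != [::]) u : (num_words u == 1) = (u == one_word sN).
Proof.
apply/idP/eqP => [|->//]; rewrite /num_words.
case uE: (words u) => [|A [|]] // _; apply: val_inj => /=.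
by rewrite uE (words1 uE).
Qed.

Lemma AP_le1 (sN : s != [::]) u : (u <= one_word sN)%O.
Proof. by apply/refinesP => A _; exists setT; rewrite ?inE ?subsetT. Qed.

Lemma AP_le_sub u v A B x :
  (u <= v)%O -> A \in words u -> B \in words v -> x \in A -> x \in B ->
  A \subset B.
Proof.
move=> /refinesP uv Au Bv xA xB; have [C Cv AC] := uv A Au.
by rewrite (AP_inj Bv Cv xB (subsetP AC _ xA)).
Qed.

Definition lastw u := last set0 (words u).

Lemma lastw_in u : 0 < num_words u -> lastw u \in words u.
Proof.
rewrite /lastw /num_words; case: (words u) => //= A w _; exact: mem_last.
Qed.

Lemma lastw_max u A :
  A \in words u -> A != lastw u -> first_index A < first_index (lastw u).
Proof.
rewrite /lastw; have := AP_sorted u; case/lastP: (words u) => // w B.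
rewrite last_rcons mem_rcons inE sorted_pairwise ?pairwise_rcons; last first.
  exact: first_index_trans.
by case/andP=> /allP h _ /predU1P[->|/h //]; rewrite eqxx.
Qed.

Lemma lastw_eq u X :
  X \in words u ->
  (forall A, A \in words u -> first_index A <= first_index X) ->
  lastw u = X.
Proof.
move=> Xu Xmax; apply/eqP; apply: contraT; rewrite eq_sym => neX.
have := lastw_max Xu neX; rewrite ltnNge Xmax // lastw_in //.
by rewrite /num_words; case: (words u) Xu.
Qed.

Definition step u t : bool :=
  [exists l : 'I_(num_words u).-1, words t == join_last l (words u)].

Lemma step_num_words u t : step u t -> num_words t = (num_words u).-1.
Proof. by case/existsP=> l /eqP; rewrite /num_words => ->; rewrite size_mkseq. Qed.

Lemma path_stepP u (c : seq (AP s)) (d : AP s) :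
  size c < num_words u ->
  reflect (forall k, k < size c ->
             exists2 l, l < (num_words u - k).-1 &
               words (nth d c k) = join_last l (words (nth d (u :: c) k)))
          (path step u c).
Proof.
elim: c u => [|t c IHc] u /= cu; first by left.
apply: (iffP andP) => [[ut tc]|h].
  have tu := step_num_words ut.
  have ct : size c < num_words t by rewrite tu -ltnS (ltn_predK cu).
  have {}IHc := IHc t ct; move/IHc: tc => tc [_|k kc] /=.
    by case/existsP: ut => l /eqP ->; exists (val l); rewrite // subn0 ltn_ord.
  have [l lk ->] := tc k kc; exists l => //.
  by rewrite (leq_trans lk) // tu; case: (num_words u) cu.
have ut : step u t.
  have [//|l] := h 0; rewrite subn0 => lu /eqP e.
  by apply/existsP; exists (Ordinal lu).
have tu := step_num_words ut; split=> //.
apply/IHc => [|k kc]; first by rewrite tu -ltnS (ltn_predK cu).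
have [l lk e] := h k.+1 kc; exists l => //.
by rewrite (leq_trans lk) // tu; case: (num_words u) cu.
Qed.

Lemma num_shufflesE (sN : s != [::]) u :
  num_shuffles u = num_paths step (pred1 (one_word sN)) (num_words u).-1 u.
Proof.
have : 0 < num_words u by apply: size_AP_gt0.
rewrite /num_shuffles /is_shuffle.
move uN: (num_words u) => [//|m] _; rewrite -card_paths /=.
rewrite -(card_in_imset (f := fun c : m.-tuple (AP s) => [tuple of u :: c])); last first.
  by move=> c d _ _ [] /val_inj.
apply: eq_card => c; case/tupleP: c => y c; rewrite inE.
apply/and3P/imsetP => [[/eqP /= -> /eqP cm /forallP cS]|[d]].
  exists c; last exact: val_inj.
  rewrite inE; apply/andP; split; last first.
    by rewrite (last_nth u) size_tuple /= -val_eqE /= cm.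
  apply/(path_stepP u) => [|k]; rewrite size_tuple ?uN // => km.
  have /existsP[l /eqP e] := cS (Ordinal km); exists l => //.
  by rewrite -subnS ltn_ord.
rewrite inE => /andP[dP dl] /(congr1 val)/= [-> ->]; split.
- exact: eqxx.
- by move: dl; rewrite (last_nth u) size_tuple /= -val_eqE.
apply/forallP => k; apply/existsP.
have [||l lk e] := (path_stepP u _ dP) k; rewrite ?size_tuple ?uN //.
have {}lk : l < m.+1 - k.+1 by rewrite -uN subnS.
by exists (Ordinal lk); rewrite /= -e.
Qed.



Lemma num_shuffles_step (sN : s != [::]) u :
  1 < num_words u -> num_shuffles u = \sum_(t | step u t) num_shuffles t.
Proof.
rewrite (num_shufflesE sN); case uN: (num_words u) => [|[|m]] // _.
apply: eq_bigr => t ut; rewrite (num_shufflesE sN).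
by rewrite (step_num_words ut) uN.
Qed.

Lemma AP_setD u A B : A \in words u -> B \in words u -> A != B -> A :\: B = A.
Proof.
move=> Au Bu neAB; apply/setP => x; rewrite inE.
case xA: (x \in A); rewrite ?andbF // andbT.
by apply: contraNN neAB => xB; apply/eqP/(AP_inj Au Bu xA xB).
Qed.

Lemma join_last_rcons n l (w : seq (subword n)) (X : subword n) :
  join_last l (rcons w X) =
  mkseq (fun i => if i == l then nth set0 w i :|: X else nth set0 w i) (size w).
Proof.
rewrite /join_last size_rcons last_rcons /=; apply/eq_in_map => i.
by rewrite mem_iota /= => iw; rewrite nth_rcons iw.
Qed.

Lemma step_words u t :
  step u t -> words u = rcons [seq A :\: lastw u | A <- words t] (lastw u).
Proof.
case/existsP => l /eqP ->.
have := @AP_setD u; have := AP_uniq u; rewrite /lastw /num_words in l *.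
case/lastP: (words u) l => [[] //|w X] l; rewrite last_rcons join_last_rcons.
rewrite rcons_uniq => /andP[Xw _] setDX; congr rcons.
rewrite -[LHS](mkseq_nth set0) /mkseq -map_comp; apply/eq_in_map => i.
rewrite mem_iota /= => iw.
have wiX : nth set0 w i :\: X = nth set0 w i.
  apply: setDX; rewrite ?mem_rcons ?inE ?eqxx ?mem_nth ?orbT //.
  by apply: contraNneq Xw => <-; rewrite mem_nth.
by case: ifP; rewrite ?setDUl ?setDv ?setU0 wiX.
Qed.

Lemma step_le u t : step u t -> (u <= t)%O.
Proof.
move=> ut; have ue := step_words ut; apply/refinesP => A.
rewrite {1}ue mem_rcons inE => /predU1P[->|/mapP[B Bt ->]]; last first.
  by exists B; rewrite ?subsetDl.
case/existsP: ut => l /eqP te.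
have lt : l < size (words t) by rewrite te size_mkseq.
exists (nth set0 (words t) l); first exact: mem_nth.
by rewrite te nth_mkseq ?ltn_ord // eqxx subsetUr.
Qed.

Lemma step_lastw u t : step u t -> lastw u \notin words t.
Proof.
move=> ut; apply/negP => Xt.
have : set0 \in words u.
  rewrite (step_words ut) mem_rcons inE; apply/orP; right.
  by apply/mapP; exists (lastw u); rewrite ?setDv.
by move/AP_neq0; rewrite eqxx.
Qed.

Lemma lastw_le v t : (v <= t)%O -> lastw v \in words t -> lastw t = lastw v.
Proof.
move=> vt Xt; apply: lastw_eq => // A At.
have /set0Pn[x xA] := AP_neq0 At; have [C Cv xC] := AP_cover v x.
have CA := AP_le_sub vt Cv At xC xA.
apply: leq_trans (first_index_subset (AP_neq0 Cv) CA) _.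
by have [->//|/(lastw_max Cv)/ltnW] := eqVneq C (lastw v).
Qed.

Lemma step_inj v t1 t2 t :
  (v <= t1)%O -> lastw v \in words t1 -> step t1 t ->
  (v <= t2)%O -> lastw v \in words t2 -> step t2 t -> t1 = t2.
Proof.
move=> vt1 X1 st1 vt2 X2 st2; apply: val_inj => /=.
by rewrite (step_words st1) (step_words st2) !(@lastw_le v).
Qed.

Section Split.
Variables v t : AP s.
Hypotheses (v0 : 0 < num_words v) (vt : (v <= t)%O).
Hypothesis Xt : lastw v \notin words t.
Local Notation X := (lastw v).
Let Xv : X \in words v := lastw_in v0.

Let early A : A \in words t ->
  exists c, [/\ c \in A, c \notin X & c < first_index X].
Proof.
move=> At; have /subsetPn[x xA xX] : ~~ (A \subset X).
  apply: contra Xt => AX; have /set0Pn[x xA] := AP_neq0 At.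
  have xX := subsetP AX _ xA.
  suff -> : X = A by [].
  by apply/eqP; rewrite eqEsubset AX (AP_le_sub vt Xv At xX xA).
have [C Cv xC] := AP_cover v x; have CA := AP_le_sub vt Cv At xC xA.
have [c cC cE] := first_index_in (AP_neq0 Cv); exists c.
have cX : c < first_index X.
  by rewrite -cE lastw_max //; apply: contraNneq xX => <-.
split=> //; first exact: (subsetP CA).
by apply/negP => /first_index_le; rewrite leqNgt cX.
Qed.

Definition split_last := rcons [seq A :\: X | A <- words t] X.

Let first_split A : A \in words t -> first_index (A :\: X) = first_index A.
Proof.
move=> At; have [c [cA cX clt]] := early At.
have [i iA iE] := first_index_in (AP_neq0 At).
have iX : i \notin X.
  apply/negP => /first_index_le; rewrite leqNgt -iE.
  by rewrite (leq_ltn_trans (first_index_le cA) clt).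
apply/eqP; rewrite eqn_leq {1}iE first_index_le ?inE ?iX //=.
by rewrite first_index_subset ?subsetDl //; apply/set0Pn; exists i; rewrite inE iX.
Qed.

Lemma split_last_partition : is_partition split_last.
Proof.
apply: is_partitionI.
- move=> x; case xX: (x \in X).
    by exists X; rewrite ?mem_rcons ?mem_head.
  have [A At xA] := AP_cover t x; exists (A :\: X); last by rewrite inE xX.
  by rewrite mem_rcons inE; apply/orP; right; apply: map_f.
- move=> A B x; rewrite !mem_rcons !inE.
  case/predU1P=> [->|/mapP[A' A't ->]] /predU1P[->|/mapP[B' B't ->]] //.
  + by rewrite inE => ->.
  + by rewrite inE => /andP[/negbTE->].
  + by rewrite !inE => /andP[_ xA] /andP[_ xB]; rewrite (AP_inj A't B't xA xB).
- rewrite mem_rcons inE eq_sym (negbTE (AP_neq0 Xv)) /=.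
  apply/mapP => -[A /early[c [cA cX _]] /setP/(_ c)].
  by rewrite !inE cA cX.
rewrite sorted_pairwise ?pairwise_rcons; last exact: first_index_trans.
apply/andP; split.
  apply/allP => _ /mapP[A At ->]; rewrite first_split //.
  have [c [cA _]] := early At; exact/leq_ltn_trans/first_index_le.
rewrite pairwise_map; have := AP_sorted t.
rewrite sorted_pairwise; last exact: first_index_trans.
apply: (sub_in_pairwise (P := mem (words t))); last exact/allP.
by move=> A B At Bt /=; rewrite !first_split.
Qed.

Lemma split_last_admissible : admissible split_last.
Proof.
apply/admissibleP => j A jw; rewrite mem_rcons inE => /predU1P[->|].
  have /admissibleP : admissible (words v) by case: (v) => u /= /andP[].
  exact.
case/mapP => B Bt ->; have [c [cB cX _]] := early Bt.
have D0 : B :\: X != set0 by apply/set0Pn; exists c; rewrite inE cX.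
apply/negP; rewrite /inner.
have [x + ->] := first_index_in D0; have [y + ->] := last_index_in D0.
rewrite !inE => /andP[yX yB] /andP[xX xB] /and3P[jBX xj jy].
move: jBX; rewrite (AP_admissible jw Bt xB yB xj jy) andbT negbK => jX.
have [C Cv yC] := AP_cover v y.
have neC : C != X by apply: contraNneq yX => <-.
have [z zC zE] := first_index_in (AP_neq0 Cv).
have zj : z < j.
  by rewrite -zE (leq_trans (lastw_max Cv neC)) ?first_index_le.
have jC := AP_admissible jw Cv zC yC zj jy.
by move: neC; rewrite (AP_inj Cv Xv jC jX) eqxx.
Qed.

Lemma split_lastP :
  exists u, [/\ (v <= u)%O, lastw v \in words u & step u t].
Proof.
have uP : is_partition split_last && admissible split_last.
  by rewrite split_last_partition split_last_admissible.
exists (MkAP uP); split.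
- apply/refinesP => A Av /=; have [->|neA] := eqVneq A X.
    by exists X; rewrite ?mem_rcons ?mem_head.
  have [B Bt AB] := refinesP _ _ vt A Av; exists (B :\: X).
    by rewrite mem_rcons inE; apply/orP; right; apply: map_f.
  by rewrite -(AP_setD Av Xv neA) setSD.
- by rewrite mem_rcons mem_head.
have [B Bt XB] := refinesP _ _ vt X Xv.
have lt : index B (words t) < size (words t) by rewrite index_mem.
have lP : index B (words t) < (num_words (MkAP uP)).-1.
  by rewrite /num_words size_rcons size_map.
apply/existsP; exists (Ordinal lP); rewrite /= join_last_rcons size_map.
apply/eqP; rewrite -[LHS](mkseq_nth set0); apply/eq_in_map => i.
rewrite mem_iota /= => it; rewrite (nth_map set0) //; case: eqP => [->|/eqP il].
  by rewrite nth_index // -{1}(setID B X) (setIidPr XB) setUC.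
apply/setP => x; rewrite inE; case xA: (x \in nth set0 (words t) i); rewrite ?andbF ?andbT //.
apply/esym; apply: contra il => /(subsetP XB) xB.
by rewrite -(AP_inj (mem_nth _ it) Bt xA xB) index_uniq ?AP_uniq.
Qed.

End Split.

End Words.

Lemma sum_shuffles0 (s : seq letter) (sN : s != [::]) (v : AP s) :
  1 < num_words v ->
  (\sum_(t : AP s | (v <= t)%O)
     (-1) ^+ (num_words t).-1 * (num_shuffles t)%:R = 0 :> int)%R.
Proof.
move=> v1; have v0 := ltnW v1; set X := lastw v.
rewrite (bigID (fun t : AP s => X \in words t)) /=.
pose f (t : AP s) : int := ((-1) ^+ (num_words t).-1 * (num_shuffles t)%:R)%R.
rewrite (eq_bigr (fun t => \sum_(t' | step t t') - f t')%R); last first.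
  move=> t /andP[vt Xt].
  have t1 : 1 < num_words t.
    rewrite ltn_neqAle size_AP_gt0 // andbT eq_sym.
    apply: contraTneq (v1) => tN; move: Xt; rewrite /num_words in tN *.
    case tE: (words t) tN => [|A []] // _; rewrite inE (words1 tE) => /eqP XT.
    have all_X B : B \in words v -> B = X.
      move=> Bv; have /set0Pn[x xB] := AP_neq0 Bv.
      by apply: (AP_inj Bv (lastw_in v0) xB); rewrite -/X XT inE.
    move: v1 (AP_uniq v) all_X; rewrite /num_words.
    case: (words v) => [|B [|C w]] // _ /= /andP[+ _] all_X.
    have Bw : B \in [:: B, C & w] by apply: mem_head.
    have Cw : C \in [:: B, C & w] by rewrite !inE eqxx orbT.
    rewrite (etrans (all_X B Bw) (esym (all_X C Cw))).
    by rewrite mem_head.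
  rewrite (num_shuffles_step sN t1) raddf_sum mulr_sumr; apply: eq_bigr => t'.
  rewrite /f => /step_num_words ->; case: (num_words t) t1 => [|[|m]] //= _.
  by rewrite exprS mulN1r mulNr.
rewrite (exchange_big_dep (fun t' => (v <= t')%O && (X \notin words t'))) /=.
  rewrite -big_split big1 //= => t' /andP[vt' Xt'].
  have [u [vu Xu ut']] := split_lastP v0 vt' Xt'.
  rewrite (big_pred1 u) ?addNr // => t /=; apply/andP/eqP => [[/andP[vt Xt] tt']|->].
    exact: (step_inj vt Xt tt' vu Xu ut').
  by rewrite vu Xu.
move=> t t' /andP[vt Xt] tt'; rewrite (le_trans vt (step_le tt')) /=.
by rewrite /X -(lastw_le vt Xt) step_lastw.
Qed.

Theorem corollary5p10 (s : seq letter) (sN : s != [::]) (v : AP s) :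
  mobius v (one_word sN) = ((-1) ^+ (num_words v).-1 * (num_shuffles v)%:R)%R.
Proof.
apply: (mobius_dual_unique (f := fun v =>
  ((-1) ^+ (num_words v).-1 * (num_shuffles v)%:R)%R)); last exact: AP_le1.
  by rewrite (num_shufflesE sN) /= eqxx.
move=> u; rewrite lt_neqAle -num_words1 => /andP[u1 _].
under eq_bigl do rewrite AP_le1 andbT.
by apply: sum_shuffles0; rewrite // ltn_neqAle eq_sym u1 size_AP_gt0.
Qed.
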